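(* Let $A$ be a quantum polynomial algebra on $n+1$ variables, with point variety $\mathrm{pts}(A)\subset\mathbb{P}^n$. Then the collection $$C_A=\{\mathbb{P}(i,j,k)\mid \mathbb{P}(i,j,k)\not\subset \mathrm{pts}(A)\}$$ of coordinate planes in $\mathbb{P}^n$ is an adequate collection.
   Context: A quantum polynomial algebra on $n+1$ variables is $A=\mathbb{C}\langle x_0,\dots,x_n\rangle/(x_ix_j-q_{ij}x_jx_i,\ 0\le i,j\le n)$ with all $q_{ij}\in\mathbb{C}^*$, $q_{ii}=1$, $q_{ji}=q_{ij}^{-1}$, graded with every $x_i$ in degree one; $A_1$ is the degree-one part. A point module of $A$ is a graded left $A$-module $P=P_0\oplus P_1\oplus\cdots$ which is cyclic (generated by one element of degree zero), critical (with respect to Gelfand–Kirillov dimension: every proper quotient has strictly smaller dimension; this implies that every normalizing element of $A$ acts on $P$ either as zero or as a non-zero-divisor), and has Hilbert series $(1-t)^{-1}$, i.e. $\dim_{\mathbb{C}}P_i=1$ for all $i\ge 0$. Such a $P$ can be written as $A/(Al_1+\cdots+Al_n)$ with $l_1,\dots,l_n\in A_1$ linearly independent; if $l_m=\sum_i c_{mi}x_i$, the associated point $x_P=[u_0:\dots:u_n]\in\mathbb{P}^n=\mathbb{P}(A_1^* )$ is the unique solution of $\sum_i c_{mi}u_i=0$ for $m=1,\dots,n$. The point variety is the reduced closed subvariety $\mathrm{pts}(A)=\{x_P\mid P\text{ a point module of }A\}\subset\mathbb{P}^n$. For distinct $i,j,k\in\{0,\dots,n\}$, $\mathbb{P}(i,j,k)$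 is the linear plane in $\mathbb{P}^n$ spanned by the coordinate points $\delta_i,\delta_j,\delta_k$, where $\delta_j=[\delta_{0j}:\dots:\delta_{nj}]$ (so it depends only on the set $\{i,j,k\}$). A collection $C$ of planes of the form $\mathbb{P}(i,j,k)$ in $\mathbb{P}^n$ is adequate if for every $0\le i\le n$ and every $\mathbb{P}(j,k,l)\in C$ there exists a two-element subset $\{u,v\}\subset\{j,k,l\}$ such that $\mathbb{P}(i,u,v)\in C$ (in particular $i\notin\{u,v\}$). *)

(* Defs.v *)
From HB Require Import structures.
From mathcomp Require Import all_boot all_order all_algebra.
From mathcomp Require Import complex.
From mathcomp Require Import all_classical all_reals all_analysis.
From mathcomp Require Import -(notations) monalg.

Set Implicit Arguments.
Unset Strict Implicit.
Unset Printing Implicit Defensive.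

Import Order.TTheory GRing.Theory Num.Theory.
Local Open Scope classical_set_scope.
Local Open Scope ring_scope.
Local Open Scope complex_scope.

Section LinearAlgebra.
Context {K : fieldType} {U : lmodType K}.

Definition lin_indep (d : nat) (b : 'I_d -> U) : Prop :=
  forall c : 'I_d -> K, \sum_(i < d) c i *: b i = 0 -> forall i, c i = 0.

Definition lin_span (X : set U) : set U :=
  [set u | exists s : seq (K * U),
     (forall t, t \in s -> X t.2) /\ u = \sum_(t <- s) t.1 *: t.2].

Record lin_subspace (V : set U) : Prop := LinSubspace {
  lin_subspace0 : V 0;
  lin_subspaceP : forall (c : K) (u w : U), V u -> V w -> V (c *: u + w) }.

(* Dimension of a subspace [V] of a possibly infinite-dimensional space. *)
Definition lin_dim (R : realType) (V : set U) : \bar R :=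
  ereal_sup [set (d%:R)%:E | d in
    [set d : nat | exists b : 'I_d -> U, (forall i, V (b i)) /\ lin_indep b]].

End LinearAlgebra.
Arguments lin_dim {K U} R V.

(* An [A]-module seen as a vector space over the ground field of [A]. *)
Definition restrict_scalars (K : fieldType) (A : algType K) (M : lmodType A)
  : Type := M.

Section RestrictScalars.
Context {K : fieldType} {A : algType K} (M : lmodType A).
Local Notation V := (restrict_scalars M).

HB.instance Definition _ := GRing.Zmodule.on V.

Let scale (c : K) (m : V) : V := (c%:A : A) *: (m : M).

Fact restrict_scalarsA a b v : scale a (scale b v) = scale (a * b) v.
Proof. by rewrite /scale scalerA -scalerAl mul1r scalerA. Qed.

Fact restrict_scalars1 : left_id 1 scale.
Proof. by move=> v; rewrite /scale scale1r scale1r. Qed.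

Fact restrict_scalarsDr : right_distributive scale +%R.
Proof. by move=> a u v; apply: scalerDr. Qed.

Fact restrict_scalarsDl v : {morph scale^~ v : a b / a + b}.
Proof. by move=> a b; rewrite /scale scalerDl scalerDl. Qed.

HB.instance Definition _ := GRing.Zmodule_isLmodule.Build K V
  restrict_scalarsA restrict_scalars1 restrict_scalarsDr restrict_scalarsDl.

End RestrictScalars.

Section GelfandKirillov.
Context (R : realType) {K : fieldType} {A : algType K}.

(* The products of at most [d] elements of [a] applied to elements of [s]:
   they span $V^{(d)} F$, where $V$, $F$ are the spans of [a], [s] and
   $V^{(d)} = K + V + \dots + V^d$. *)
Fixpoint gk_generators (M : lmodType A) (a : seq A) (s : seq M) (d : nat)
  : seq M :=
  if d is d'.+1 then
    gk_generators a s d' ++ [seq b *: m | b <- a, m <- gk_generators a s d']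
  else s.

(* $\sup_{V, F} \limsup_d \log_d \dim (V^{(d)} F)$ over the finite-dimensional
   subspaces $V \subseteq A$ and $F \subseteq M$.  As [lne 0 = -oo], the zero
   module has dimension [-oo]. *)
Definition gkdim (M : lmodType A) : \bar R :=
  ereal_sup [set y : \bar R | exists (a : seq A) (s : seq M),
    y = limn_esup (fun d : nat =>
      (lne (lin_dim R (lin_span
         [set m : restrict_scalars M | m \in (gk_generators a s d : seq M)]))
       * ((ln (d%:R : R))^-1)%:E)%E)].

(* A proper quotient is given by a surjective, non-injective linear map. *)
Definition critical (M : lmodType A) : Prop :=
  forall (Q : lmodType A) (f : {linear M -> Q}),
    (forall y, exists m, f m = y) -> ~ injective f -> (gkdim Q < gkdim M)%E.

End GelfandKirillov.

Section QuantumPolynomialAlgebra.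
Context {R : realType} {n : nat}.
Local Notation C := (R[i]).

Definition free_algebra := malg (fmonom 'I_n.+1) C.

Definition free_gen (i : 'I_n.+1) : free_algebra :=
  mkmalgU (fmu i) 1.

Definition two_sided_ideal (X : set free_algebra) : set free_algebra :=
  [set f | exists s : seq (free_algebra * free_algebra * free_algebra),
     (forall t, t \in s -> X t.1.2) /\
     f = \sum_(t <- s) t.1.1 * t.1.2 * t.2].

Definition quantum_relations (q : 'M[C]_n.+1) : set free_algebra :=
  [set f | exists i j,
     f = free_gen i * free_gen j - q i j *: (free_gen j * free_gen i)].

(* [A], with generators [x], is isomorphic to the quotient of the free algebra
   by the two-sided ideal of the quantum relations. *)
Record quantum_polynomial_algebra (q : 'M[C]_n.+1) (A : algType C)
    (x : 'I_n.+1 -> A) : Prop := QuantumPolynomialAlgebra {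
  qpa_neq0 : forall i j, q i j != 0;
  qpa_diag : forall i, q i i = 1;
  qpa_inv : forall i j, q j i = (q i j)^-1;
  qpa_presentation : exists f : {lrmorphism free_algebra -> A},
    [/\ forall i, f (free_gen i) = x i,
        forall a, exists w, f w = a
      & forall w, f w = 0 <-> two_sided_ideal (quantum_relations q) w] }.

End QuantumPolynomialAlgebra.

Section PointModules.
Context {R : realType} {n : nat}.
Local Notation C := (R[i]).
Context {A : algType C} (x : 'I_n.+1 -> A).

Definition homog_part (d : nat) : set A :=
  lin_span [set a : A | exists w : d.-tuple 'I_n.+1, a = \prod_(i <- w) x i].

Record module_grading (M : lmodType A) (gr : nat -> set M) : Prop :=
ModuleGrading {
  mgr_subspace : forall d, @lin_subspace C (restrict_scalars M) (gr d);
  mgr_action : forall d e a m, homog_part d a -> gr e m -> gr (d + e)%N (a *: m);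
  mgr_decomp : forall m, exists (N : nat) (f : nat -> M),
    (forall d, gr d (f d)) /\ m = \sum_(d < N) f d;
  mgr_direct : forall (N : nat) (f : nat -> M), (forall d, gr d (f d)) ->
    \sum_(d < N) f d = 0 -> forall d, (d < N)%N -> f d = 0 }.

Record point_module (P : lmodType A) (gr : nat -> set P) : Prop :=
PointModule {
  pm_grading : module_grading gr;
  pm_cyclic : exists2 v, gr 0%N v & forall m, exists a, m = a *: v;
  pm_critical : critical R P;
  pm_hilbert : forall d, @lin_dim C (restrict_scalars P) R (gr d) = 1%E }.

(* Points of projective space are the lines through the origin. *)
Definition proj_point := {L : {vspace 'rV[C]_n.+1} | \dim L == 1%N}.

(* [p] is the point of [P], where [P] is written as the quotient of [A] by the
   left ideal generated by [l], through the map [a |-> a *: v]. *)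
Definition associated_point (P : lmodType A) (gr : nat -> set P)
    (p : proj_point) : Prop :=
  exists (v : P) (l : 'I_n -> A) (c : 'M[C]_(n, n.+1)),
    [/\ gr 0%N v,
        forall m, exists a, m = a *: v,
        forall a, a *: v = 0 <->
          exists b : 'I_n -> A, a = \sum_(m < n) b m * l m,
        lin_indep l /\ (forall m, l m = \sum_i c m i *: x i)
      & forall u : 'rV[C]_n.+1,
          u \in val p <-> forall m, \sum_i c m i * u 0 i = 0].

Definition point_variety : set proj_point :=
  [set p | exists (P : lmodType A) (gr : nat -> set P),
     point_module gr /\ associated_point gr p].

End PointModules.
Arguments proj_point R n : clear implicits.

Section CoordinatePlanes.
Context {R : realType} {n : nat}.
Local Notation C := (R[i]).

Definition coord_point (i : 'I_n.+1) : 'rV[C]_n.+1 := delta_mx 0 i.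

Definition coord_plane (i j k : 'I_n.+1) : set (proj_point R n) :=
  [set p : proj_point R n |
     (val p <= <<[:: coord_point i; coord_point j; coord_point k]>>)%VS].

Definition distinct3 (i j k : 'I_n.+1) : bool :=
  [&& i != j, i != k & j != k].

Definition adequate (D : set (set (proj_point R n))) : Prop :=
  (forall L, D L -> exists i j k, distinct3 i j k /\ L = coord_plane i j k) /\
  (forall i j k l, distinct3 j k l -> D (coord_plane j k l) ->
     exists u v, [/\ u \in [:: j; k; l], v \in [:: j; k; l],
       distinct3 i u v & D (coord_plane i u v)]).

(* $C_A$ is [planes_not_in (point_variety x)]. *)
Definition planes_not_in (X : set (proj_point R n))
  : set (set (proj_point R n)) :=
  [set L | exists i j k,
     [/\ distinct3 i j k, L = coord_plane i j k & ~ (L `<=` X)]].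

End CoordinatePlanes.

(* Main.v *)
From HB Require Import structures.
Require Import Defs.
From mathcomp Require Import all_boot all_order all_algebra.
From mathcomp Require Import complex.
From mathcomp Require Import all_classical all_reals all_analysis.
From mathcomp Require Import ring.
From mathcomp Require Import -(notations) finmap.
From mathcomp Require Import -(notations) monalg.

Set Implicit Arguments.
Unset Strict Implicit.
Unset Printing Implicit Defensive.

Import Order.TTheory GRing.Theory Num.Theory.
Local Open Scope classical_set_scope.
Local Open Scope ring_scope.
Local Open Scope complex_scope.

(** Write [t(i,j,k)] for [q i j * q j k * q k i].  The proof shows that a
    coordinate plane is contained in the point variety if and only if
    [t(i,j,k) = 1].  Adequacy follows: since [q i j * q j i = 1],

      [t(i,j,k) * t(i,k,l) * t(i,l,j) = t(j,k,l)],

    so if [t(j,k,l)] differs from [1], one of the three factors on the left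
    does, and the corresponding plane through the [i]-th coordinate point is
    not in the point variety.

    If the plane is in the point variety ([point_variety_eq1]), take a point
    module [P] over the point [u] with coordinates [1] at [i], [j], [k] and [0]
    elsewhere, generated by [v] in degree 0.  A linear form vanishing at [u]
    annihilates [v], so every generator acts by [x m *: v = u m *: e] with
    [e := x i *: v].  Applying the relations to [v] gives
    [u b *: x a e = q a b * u a *: x b e]; going once around [i], [j], [k]
    yields [x i e = t(i,j,k) *: x i e].  If [t(i,j,k)] were not [1], all the
    [x m *: e] would vanish and [P] would be spanned by [v] and [e], leaving
    nothing in degree 2.

    If [t(i,j,k) = 1] ([plane_sub_point_variety]), every point [u] of the plane
    is realised on the space of polynomials in one variable, [x m] acting by
    [p(X) |-> u m * X * p(s m * X)] with [s m := q m k]; the hypothesis on [t]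
    is exactly what makes these operators satisfy the relations.  Fix a
    coordinate [i0] with [u i0 != 0].
    - The module is critical because [x i0] raises degrees by one: its powers
      applied to [1] are independent, whence GK dimension at least 1
      ([gkdim_ge1]), while any proper quotient is finite-dimensional
      ([quotient_fin]), whence GK dimension at most 0 ([gkdim_fin_le0]).
    - The annihilator of [1] is generated by the linear forms [l] vanishing at
      [u], because modulo the left ideal of the [l m] every element of [A] is a
      polynomial in [x i0] ([qpa_normal_form]), and a nonzero such polynomial
      does not kill [1].
    The same operators with [u] a coordinate point show that the generators of
    [A] are linearly independent ([qpa_gen_indep]). *)

(** * Dimension and Gelfand-Kirillov dimension *)

Section LinearDimension.
Variables (K : fieldType) (U : lmodType K) (R : realType).

(** More than [D] combinations of [D] vectors satisfy a linear relation: a row of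
    the kernel of the matrix of coefficients. *)
Lemma lin_indep_leq_span (d D : nat) (b : 'I_d -> U) (g : 'I_D -> U) :
    lin_indep b -> (forall i, exists c : 'I_D -> K, b i = \sum_j c j *: g j) ->
  (d <= D)%N.
Proof.
move=> b_free b_g; rewrite leqNgt; apply/negP => ltDd.
have [c b_c] := choice b_g.
pose M : 'M[K]_(d, D) := \matrix_(i, j) c i j.
have kerM : kermx M != 0.
  by rewrite kermx_eq0 /row_free neq_ltn (leq_ltn_trans (rank_leq_col M)).
have [i [j kij]] : exists i j, kermx M i j != 0.
  apply: contrapT => ker0; move/eqP: kerM; apply.
  apply/matrixP => i j; rewrite [RHS]mxE; apply/eqP/negPn/negP => kij.
  by apply: ker0; exists i, j.
apply/negP: kij; apply/negPn/eqP.
apply: (b_free (fun j => kermx M i j)) => {j}.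
under eq_bigr do rewrite b_c scaler_sumr.
rewrite exchange_big big1 // => j _.
under eq_bigr do rewrite scalerA.
rewrite -scaler_suml (_ : \sum_i0 _ = (kermx M *m M) i j).
  by rewrite mulmx_ker mxE scale0r.
by rewrite mxE; apply: eq_bigr => k _; rewrite [M k j]mxE.
Qed.

Lemma lin_dim_le_span (V : set U) (D : nat) (g : 'I_D -> U) :
    (forall u, V u -> exists c : 'I_D -> K, u = \sum_j c j *: g j) ->
  (lin_dim R V <= (D%:R)%:E)%E.
Proof.
move=> V_g; apply: ge_ereal_sup => _ [d [b [Vb b_free]] <-].
rewrite lee_fin ler_nat; apply: (lin_indep_leq_span b_free) => i.
exact: V_g.
Qed.

Lemma lin_dim_ge_indep (V : set U) (d : nat) (b : 'I_d -> U) :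
  (forall i, V (b i)) -> lin_indep b -> ((d%:R)%:E <= lin_dim R V)%E.
Proof. by move=> Vb b_free; apply: ereal_sup_ubound; exists d => //; exists b. Qed.

Lemma lin_dim_le0 (V : set U) :
  (forall u, V u -> u = 0) -> (lin_dim R V <= 0)%E.
Proof.
move=> V0; apply: (@lin_dim_le_span V 0 (fun=> 0)) => u /V0 ->.
by exists (fun=> 0); rewrite big_ord0.
Qed.

End LinearDimension.

Section LimitSuperior.
Variable R : realType.
Implicit Types f : nat -> \bar R.

Lemma limn_esup_ge f (l : \bar R) (N : nat) :
  (forall d, (N <= d)%N -> (l <= f d)%E) -> (l <= limn_esup f)%E.
Proof.
move=> lf; apply: le_ereal_inf_tmp => _ [V [M _ MV] <-].
apply: (le_trans (lf (maxn N M) (leq_maxl _ _))); apply: ereal_sup_ubound.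
by exists (maxn N M) => //; apply: MV; rewrite /= leq_maxr.
Qed.

Lemma limn_esup_le f (l : \bar R) (N : nat) :
  (forall d, (N <= d)%N -> (f d <= l)%E) -> (limn_esup f <= l)%E.
Proof.
move=> fl; apply: (@le_trans _ _ (ereal_sup (f @` [set d | (N <= d)%N]))).
  apply: ereal_inf_lbound; exists [set d | (N <= d)%N] => //.
  by exists N.
by apply: ge_ereal_sup => _ [d /= Nd <-]; apply: fl.
Qed.

End LimitSuperior.

Section GelfandKirillovBounds.
Variables (R : realType) (K : fieldType) (A : algType K) (M : lmodType A).
Local Notation V := (restrict_scalars M).

(** The dimensions stay bounded by a constant, and the quotient of a constant by
    [ln d] tends to 0. *)
Lemma gkdim_fin_le0 (D : nat) (g : 'I_D -> V) :
    (forall m : V, exists c : 'I_D -> K, m = \sum_j c j *: g j) ->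
  (gkdim R M <= 0)%E.
Proof.
move=> M_g; apply: ge_ereal_sup => _ [a [s ->]].
apply/lee_addgt0Pr => e e0; rewrite add0e.
(* [D.+1] rather than [D], so that the logarithm is nonnegative when [D = 0]. *)
pose B : R := ln (D.+1%:R).
have B0 : 0 <= B by rewrite ln_ge0 // ler1n.
have [N NB] : exists N : nat, forall d, (N <= d)%N -> B / e <= ln (d%:R : R).
  exists (Num.Def.truncn (expR (B / e))).+1 => d Nd.
  rewrite -[leLHS]expRK ler_ln ?posrE ?expR_gt0 //.
    by apply: (le_trans (ltW (truncnS_gt _))); rewrite ler_nat.
  by rewrite ltr0n (leq_trans _ Nd).
apply: (@limn_esup_le _ _ _ (maxn N 2)) => d; rewrite geq_max => /andP[Nd d2].
have lnd : 0 < ln (d%:R : R) by rewrite ln_gt0 // ltr1n.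
set L := lin_dim _ _.
have LD : (lne L <= B%:E)%E.
  apply: (@le_trans _ _ (lne ((D.+1%:R)%:E))); last by rewrite lne_EFin // ltr0n.
  have [L0|L0] := leP L 0%E; first by rewrite le0_lneNy // leNye.
  rewrite lee_lne ?in_itv /= ?leey ?andbT ?(ltW L0) ?lee_fin ?ler0n //.
  apply: (@le_trans _ _ ((D%:R)%:E)); last by rewrite lee_fin ler_nat.
  by apply: (@lin_dim_le_span _ _ _ _ _ g) => u _.
apply: (le_trans (lee_wpmul2r _ LD)).
  by rewrite lee_fin invr_ge0 ltW.
by rewrite -EFinM lee_fin ler_pdivrMr // mulrC -ler_pdivrMr // NB.
Qed.

(** With the subspaces spanned by [a] and by [m], the [d]-th dimension is at
    least [d.+1], and [ln d.+1 / ln d >= 1]. *)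
Lemma gkdim_ge1 (a : A) (m : M) :
    (forall d, lin_indep (fun k : 'I_d => (a ^+ k *: m : V))) ->
  (1 <= gkdim R M)%E.
Proof.
move=> am_free.
pose f d := lin_span [set w : V | w \in (gk_generators [:: a] [:: m] d : seq M)].
have f_ge d : (((d.+1)%:R : R)%:E <= lin_dim R (f d))%E.
  apply: (lin_dim_ge_indep R _ (am_free d.+1)) => -[k /= kd].
  exists [:: (1, a ^+ k *: m : V)]; split; last by rewrite big_seq1 scale1r.
  move=> t; rewrite inE => /eqP -> /=.
  elim: d k kd => [|d IH] k; first by case: k => // _; rewrite scale1r inE.
  rewrite ltnS leq_eqVlt /= mem_cat => /predU1P[->|/IH ->//].
  rewrite exprS -scalerA cats0; apply/orP; right.
  exact/(map_f (fun w : M => a *: w))/IH.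
apply: (@le_trans _ _ (limn_esup (fun d => lne (lin_dim R (f d)) *
    ((ln (d%:R : R))^-1)%:E)%E)); last first.
  by apply: ereal_sup_ubound; exists [:: a], [:: m].
(* From [d = 2] on, [ln d] is positive. *)
apply: (@limn_esup_ge _ _ _ 2) => d d2.
have lnd : 0 < ln (d%:R : R) by rewrite ln_gt0 // ltr1n.
have : (((ln (d%:R : R))%:E) <= lne (lin_dim R (f d)))%E.
  rewrite -lne_EFin ?ltr0n ?(ltn_trans _ d2) //.
  have := le_trans _ (f_ge d) => /(_ (d%:R)%:E); rewrite lee_fin ler_nat.
  move=> /(_ (leqnSn _)) dle.
  rewrite lee_lne ?in_itv /= ?leey ?andbT ?lee_fin ?ler0n //.
  by rewrite (le_trans _ dle) ?lee_fin.
move=> /(lee_wpmul2r _) => /(_ ((ln (d%:R : R))^-1)%:E).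
rewrite lee_fin invr_ge0 ltW // => /(_ isT).
by rewrite -EFinM mulfV ?gt_eqF.
Qed.

End GelfandKirillovBounds.

(** * Modules over the free algebra and over its quotient *)

Section WordAction.
Variables (K : pzRingType) (I : Type) (V : lmodType K) (X : I -> {linear V -> V}).

Definition word_act (w : seq I) (v : V) : V := foldr (fun i => X i) v w.

Lemma word_act_linear w : linear (word_act w).
Proof. by move=> c u v; elim: w => //= i w ->; rewrite linearP. Qed.

HB.instance Definition _ (w : seq I) :=
  GRing.isLinear.Build K V V *:%R (word_act w) (word_act_linear w).

End WordAction.

Section FreeAlgebra.
Variables (R : realType) (n : nat).
Local Notation C := (R[i]).
Local Notation F := (@free_algebra R n).
Local Notation word := (fmonom 'I_n.+1).

Lemma free_monomialE (k : word) (c : C) :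
  mkmalgU k c = c *: \prod_(i <- (k : seq 'I_n.+1)) free_gen i :> F.
Proof.
have -> : \prod_(i <- (k : seq 'I_n.+1)) free_gen i = mkmalgU k 1 :> F.
  rewrite -[in RHS](fmK k); elim: (fmonom_val k) => [|i s IH].
    by rewrite big_nil -fmoneE.
  by rewrite big_cons IH malgM_def fgmulUU mulr1 /= /mmul /= fmuE fmmulE.
apply/malgP => j; rewrite (mcoeffZ c (mkmalgU k 1)).
by rewrite (mcoeffU k c) (mcoeffU k 1) mulrnAr mulr1.
Qed.

Section Operators.
Variables (V : lmodType C) (X : 'I_n.+1 -> {linear V -> V}).

(** The module structure over the free algebra in which the [i]-th generator acts
    by [X i].  The vector comes first so that the partial application is the
    linear map [g |-> g v]. *)
Definition free_act (v : V) (g : F) : V :=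
  \sum_(k <- msupp g) mcoeff k g *: word_act X k v.

Lemma free_actEw (d : finSet word) g v : fsubset (msupp g) d ->
  free_act v g = \sum_(k <- d) mcoeff k g *: word_act X k v.
Proof.
move=> gd; rewrite /free_act (big_fset_incl _ gd) // => k _ /mcoeff_outdom ->.
by rewrite scale0r.
Qed.

Lemma free_act_linear v : linear (free_act v).
Proof.
move=> c g h /=.
pose d := fsetU (msupp (c *: g + h)) (fsetU (msupp g) (msupp h)).
have [dl dg dh] : [/\ fsubset (msupp (c *: g + h)) d, fsubset (msupp g) d
    & fsubset (msupp h) d].
  by apply/and3P; rewrite -!fsubUset fsubset_refl.
rewrite !(@free_actEw d) // scaler_sumr -big_split; apply: eq_bigr => k _ /=.
by rewrite mcoeffD mcoeffZ scalerDl scalerA.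
Qed.

HB.instance Definition _ v :=
  GRing.isLinear.Build C F V *:%R (free_act v) (free_act_linear v).

Lemma free_actD u v g : free_act (u + v) g = free_act u g + free_act v g.
Proof.
rewrite /free_act -big_split; apply: eq_bigr => k _ /=.
by rewrite linearD scalerDr.
Qed.

Lemma free_actU k c v : free_act v (mkmalgU k c) = c *: word_act X k v.
Proof. by rewrite (free_actEw _ msuppU_le) big_seq_fset1 mcoeffUU. Qed.

Lemma free_act1 v : free_act v 1 = v.
Proof. by rewrite [1]/(mkmalgU mone 1) free_actU scale1r fm1. Qed.

Lemma free_act_gen i v : free_act v (free_gen i) = X i v.
Proof. by rewrite free_actU scale1r fmuE. Qed.

Lemma free_actM g h v : free_act v (g * h) = free_act (free_act v h) g.
Proof.
rewrite malgME linear_sum /=; apply: eq_bigr => k _.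
have -> : free_act v h = \sum_(l <- msupp h) mcoeff l h *: word_act X l v by [].
rewrite !linear_sum /=; apply: eq_bigr => l _.
by rewrite free_actU linearZ scalerA /= /word_act -foldr_cat fmM.
Qed.

End Operators.
End FreeAlgebra.

Section Action.
Variables (A : pzRingType) (V : zmodType) (act : A -> V -> V).

(** The axioms of a module structure over [A] on [V], kept as a proposition
    because the action is only obtained inside a proof; [action_module] turns
    such an action into an [A]-module. *)
Record module_action : Prop := ModuleAction {
  mactA : forall a b v, act a (act b v) = act (a * b) v;
  mact1 : left_id 1 act;
  mactDr : right_distributive act +%R;
  mactDl : forall v, {morph act^~ v : a b / a + b} }.

Variable act_ok : module_action.

Definition action_module of module_action : Type := V.
Local Notation M := (action_module act_ok).

HB.instance Definition _ := GRing.Zmodule.on M.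
HB.instance Definition _ := GRing.Zmodule_isLmodule.Build A M
  (mactA act_ok) (mact1 act_ok) (mactDr act_ok) (mactDl act_ok).

End Action.

Section QuantumAction.
Variables (R : realType) (n : nat) (q : 'M[R[i]]_n.+1).
Local Notation C := (R[i]).
Variables (A : algType C) (x : 'I_n.+1 -> A).
Hypothesis hA : quantum_polynomial_algebra q x.

Lemma qpa_commute i j : x i * x j = q i j *: (x j * x i).
Proof.
have [f [fx _ f0]] := qpa_presentation hA.
apply/eqP; rewrite -subr_eq0 -!fx -!rmorphM -linearZ -raddfB /=; apply/eqP/f0.
exists [:: (1, free_gen i * free_gen j - q i j *: (free_gen j * free_gen i), 1)].
split; last by rewrite big_seq1 /= mul1r mulr1.
by move=> t; rewrite inE => /eqP -> /=; exists i, j.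
Qed.

(** [A] is the linear span of the words in its generators, being a quotient of the
    free algebra. *)
Lemma qpa_ind (S : A -> Prop) :
    S 1 -> (forall c a b, S a -> S b -> S (c *: a + b)) ->
    (forall i a, S a -> S (x i * a)) ->
  forall a, S a.
Proof.
move=> S1 SP SM.
have [f [fx f_surj _]] := qpa_presentation hA.
have S0 : S 0 by rewrite -(addNr 1) -scaleN1r; apply: SP.
move=> a; have [w <-] := f_surj a; rewrite (monalgE w) raddf_sum.
elim/big_rec: _ => // k b _ Sb; rewrite /= free_monomialE linearZ; apply: SP => //=.
rewrite rmorph_prod; elim: (fmonom_val k) => [|i s IH]; first by rewrite big_nil.
by rewrite big_cons /= fx; apply: SM.
Qed.

Variables (V : lmodType C) (X : 'I_n.+1 -> {linear V -> V}).
Hypothesis X_commute : forall i j v, X i (X j v) = q i j *: X j (X i v).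

(** The presentation of [A] at work: operators satisfying the relations extend
    to the free algebra, the ideal of relations acts by zero, and so the action
    descends along the surjection onto [A]. *)
Lemma qpa_action : exists act : A -> V -> V,
  [/\ module_action act, forall i v, act (x i) v = X i v
    & forall c v, act c%:A v = c *: v].
Proof.
have [f [fx f_surj f0]] := qpa_presentation hA.
have rel_act i j v :
    free_act X v (free_gen i * free_gen j - q i j *: (free_gen j * free_gen i)) = 0.
  have gen2 a b : free_act X v (free_gen a * free_gen b) = X a (X b v).
    by rewrite free_actM !free_act_gen.
  rewrite linearB linearZ /=; apply/eqP; rewrite subr_eq0; apply/eqP.
  apply: (etrans (gen2 i j)); rewrite X_commute; congr (_ *: _).
  exact/esym/gen2.
have ker_act w v : f w = 0 -> free_act X v w = 0.
  move=> /f0[s [s_rel ->]].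
  rewrite linear_sum /= big_seq big1 // => -[[a r] b] /s_rel[i [j /= ->]].
  rewrite (free_actM X (a * _) b) (free_actM X a) rel_act.
  by rewrite /free_act big1 // => k _; rewrite linear0 scaler0.
have [g gK] := choice f_surj.
have actE w v : free_act X v (g (f w)) = free_act X v w.
  apply/eqP; rewrite -subr_eq0 -linearB; apply/eqP.
  have fB w1 w2 : f (w1 - w2) = f w1 - f w2 by exact: raddfB.
  by apply: ker_act; rewrite fB gK subrr.
have f1 : f 1 = 1 by exact: rmorph1.
exists (fun a v => free_act X v (g a)); split.
- have fM w1 w2 : f (w1 * w2) = f w1 * f w2 by exact: rmorphM.
  have fD w1 w2 : f (w1 + w2) = f w1 + f w2 by exact: raddfD.
  split=> [a b v|v|a u v|v a b].
  + by have := actE (g a * g b) v; rewrite fM !gK free_actM => ->.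
  + by have := actE 1 v; rewrite f1 free_act1.
  + by rewrite free_actD.
  + by have := actE (g a + g b) v; rewrite fD !gK linearD.
- by move=> i v; have := actE (free_gen i) v; rewrite fx free_act_gen.
- have fZ1 c : f c%:A = c%:A by apply: etrans (linearZ _ _) _; rewrite /= f1.
  by move=> c v; have := actE c%:A v; rewrite fZ1 linearZ /= free_act1.
Qed.

End QuantumAction.

(** * Skew shift operators on polynomials *)

Section ShiftOperator.
Variable K : fieldType.
Implicit Types (c z : K) (p : {poly K}).

(** The graded operator of degree one [p(X) |-> c * X * p(z * X)].  Two of them
    commute up to the ratio of their parameters [z], by [shift_op_comp]. *)
Definition shift_op c z p : {poly K} := c *: ('X * (p \Po (z *: 'X))).

Lemma shift_op_linear c z : linear (shift_op c z).
Proof.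
move=> a p r; rewrite /shift_op comp_polyD comp_polyZ mulrDr -scalerAr scalerDr.
by rewrite !scalerA mulrC.
Qed.

HB.instance Definition _ c z :=
  GRing.isLinear.Build K {poly K} {poly K} *:%R (shift_op c z)
    (shift_op_linear c z).

Lemma shift_op_comp c z c' z' p :
  shift_op c z (shift_op c' z' p) =
    (c * c' * z) *: ('X^2 * (p \Po ((z * z') *: 'X))).
Proof.
rewrite /shift_op comp_polyZ comp_polyM comp_polyX -comp_polyA comp_polyZ.
rewrite comp_polyX scalerA (mulrC z') -scalerAr scalerA -scalerAl -scalerAr.
by rewrite scalerA mulrA.
Qed.

Lemma shift_opXn c z d : shift_op c z 'X^d = (c * z ^+ d) *: 'X^(d.+1).
Proof.
by rewrite /shift_op rmorphXn /= comp_polyX exprZn -scalerAr scalerA -exprS.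
Qed.

Lemma size_shift_op c z p : c != 0 -> z != 0 -> p != 0 ->
  size (shift_op c z p) = (size p).+1.
Proof.
move=> c0 z0 p0; rewrite size_scale // mulrC size_mulX.
  by rewrite size_comp_poly2 // size_scale // size_polyX.
by rewrite -size_poly_eq0 size_comp_poly2 ?size_poly_eq0 // size_scale // size_polyX.
Qed.

End ShiftOperator.

(** * The left ideal of a point *)

Section NormalForm.
Variables (K : fieldType) (n : nat) (u : 'I_n.+1 -> K) (i0 : 'I_n.+1).

(** The linear equations of the point [u], solved for the coordinate [i0], where
    [u i0 != 0]: row [m] is the form [X_a - (u a / u i0) X_i0], with
    [a = lift i0 m] running over the indices other than [i0]. *)
Definition line_eqs : 'M[K]_(n, n.+1) :=
  \matrix_(m, j) ((j == lift i0 m)%:R - u (lift i0 m) / u i0 * (j == i0)%:R).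

Lemma line_eqsE (V : lmodType K) (F : 'I_n.+1 -> V) m :
  \sum_j line_eqs m j *: F j = F (lift i0 m) - (u (lift i0 m) / u i0) *: F i0.
Proof.
under eq_bigr do rewrite mxE scalerBl.
rewrite sumrB; congr (_ - _).
  rewrite (bigD1 (lift i0 m)) //= eqxx scale1r big1 ?addr0 // => j /negPf ->.
  by rewrite scale0r.
rewrite (bigD1 i0) //= eqxx mulr1 big1 ?addr0 // => j /negPf ->.
by rewrite mulr0 scale0r.
Qed.

(** The [m]-th form is the only one that involves the coordinate [lift i0 m]. *)
Lemma line_eqs_indep (V : lmodType K) (F : 'I_n.+1 -> V) :
  lin_indep F -> lin_indep (fun m => \sum_j line_eqs m j *: F j).
Proof.
move=> F_free d.
(* The coefficients, along [F], of the given combination of the forms. *)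
pose e j := if unlift i0 j is Some m then d m
  else - \sum_m d m * (u (lift i0 m) / u i0).
have -> : \sum_m d m *: (\sum_j line_eqs m j *: F j) = \sum_j e j *: F j.
  rewrite (bigD1_ord i0) //= {1}/e unlift_none.
  under eq_bigr do rewrite line_eqsE scalerBr scalerA.
  rewrite sumrB addrC scaleNr scaler_suml; congr (_ + _).
  by apply: eq_bigr => m _; rewrite /e liftK.
by move=> /F_free e0 m; have := e0 (lift i0 m); rewrite /e liftK.
Qed.

Lemma line_eqsP (w : 'I_n.+1 -> K) : u i0 != 0 ->
  (forall m, \sum_j line_eqs m j * w j = 0) <->
  exists k, forall j, w j = k * u j.
Proof.
move=> u0; have lw m := line_eqsE (w : 'I_n.+1 -> K^o) m.
split=> [w0|[k wk] m].
  exists (w i0 / u i0) => j; case: (unliftP i0 j) => [m|] ->; last by rewrite divfK.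
  have /eqP := w0 m; rewrite lw subr_eq0 => /eqP ->.
  by rewrite [LHS]mulrAC [RHS]mulrAC (mulrC (w i0)).
by rewrite [LHS]lw !wk [X in _ - X]mulrCA divfK // subrr.
Qed.

End NormalForm.

Section LeftIdeal.
Variables (R : realType) (n : nat) (q : 'M[R[i]]_n.+1).
Local Notation C := (R[i]).
Variables (A : algType C) (x : 'I_n.+1 -> A).
Hypothesis hA : quantum_polynomial_algebra q x.

Definition left_ideal (l : 'I_n -> A) (a : A) : Prop :=
  exists b : 'I_n -> A, a = \sum_m b m * l m.

Lemma left_idealP l c a b :
  left_ideal l a -> left_ideal l b -> left_ideal l (c *: a + b).
Proof.
move=> [b1 ->] [b2 ->]; exists (fun m => c *: b1 m + b2 m).
rewrite scaler_sumr -big_split; apply: eq_bigr => m _ /=.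
by rewrite mulrDl scalerAl.
Qed.

Lemma left_idealM l a b : left_ideal l b -> left_ideal l (a * b).
Proof.
move=> [b' ->]; exists (fun m => a * b' m).
by rewrite mulr_sumr; apply: eq_bigr => m _; rewrite mulrA.
Qed.

Lemma left_ideal_gen (l : 'I_n -> A) m : left_ideal l (l m).
Proof.
exists (fun k => (k == m)%:R); rewrite (bigD1 m) //= eqxx mul1r big1 ?addr0 //.
by move=> k /negPf ->; rewrite mul0r.
Qed.

Lemma left_ideal0 l : left_ideal l 0.
Proof. by exists (fun=> 0); rewrite big1 // => m _; rewrite mul0r. Qed.

Lemma qpa_commuteX i j d : x i * x j ^+ d = (q i j) ^+ d *: (x j ^+ d * x i).
Proof.
elim: d => [|d IH]; first by rewrite !expr0 scale1r mulr1 mul1r.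
rewrite !exprSr mulrA IH -scalerAl -[_ * x i * x j]mulrA (qpa_commute hA i j).
rewrite -scalerAr scalerA.
by rewrite mulrA.
Qed.

Lemma horner_algE (a : A) (g : {poly C}) :
  horner_alg a g = \sum_(d < size g) g`_d *: a ^+ d.
Proof.
rewrite -[in LHS](coefK g) poly_def linear_sum; apply: eq_bigr => d _.
by rewrite linearZ /= rmorphXn /= horner_algX -scalerAl mul1r.
Qed.

Variables (u : 'I_n.+1 -> C) (i0 : 'I_n.+1).
Local Notation l := (fun m => \sum_j line_eqs u i0 m j *: x j).

(** Modulo the left ideal, [x a] is a multiple of [x i0] when it stands on the
    right; since [x a] can be moved to the right of a power of [x i0], the sum of
    the ideal and of the polynomials in [x i0] is stable under left
    multiplication by the generators. *)
Lemma qpa_normal_form a : exists g, left_ideal l (a - horner_alg (x i0) g).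
Proof.
pose S a := exists g, left_ideal l (a - horner_alg (x i0) g).
have SP c b1 b2 : S b1 -> S b2 -> S (c *: b1 + b2).
  move=> [g1 I1] [g2 I2]; exists (c *: g1 + g2).
  rewrite linearD linearZ /= -scalerAl mul1r opprD addrACA -scalerBr.
  exact: left_idealP.
have SI b : left_ideal l b -> S b by exists 0; rewrite linear0 subr0.
have SX d : S (x i0 ^+ d).
  by exists 'X^d; rewrite rmorphXn /= horner_algX subrr; apply: left_ideal0.
have S0 : S 0 by apply/SI/left_ideal0.
move: a; apply: (qpa_ind hA) => // [|j a [g Ia]]; first exact: (SX 0).
rewrite -(subrK (horner_alg (x i0) g) a) mulrDr -[X in X + _]scale1r.
apply: (SP); first by apply/SI/left_idealM.
rewrite horner_algE mulr_sumr; elim/big_rec: _ => // d b _ Sb.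
rewrite -scalerAr; apply: (SP) => //; rewrite qpa_commuteX -[X in S X]addr0.
apply: (SP) => //; case: (unliftP i0 j) => [m|] ->; last by rewrite -exprSr.
have -> : x (lift i0 m) = l m + (u (lift i0 m) / u i0) *: x i0.
  by rewrite line_eqsE subrK.
rewrite mulrDr -scalerAr -exprSr addrC; apply: (SP) => //.
by apply/SI/left_idealM/left_ideal_gen.
Qed.

End LeftIdeal.

(** * Point modules on polynomials *)

Section WeightedLine.
Variables (R : realType) (n : nat) (q : 'M[R[i]]_n.+1).
Local Notation C := (R[i]).
Variables (A : algType C) (x : 'I_n.+1 -> A).
Hypothesis hA : quantum_polynomial_algebra q x.
Variables (u s : 'I_n.+1 -> C).
Variable act : A -> {poly C} -> {poly C}.
Hypothesis act_ok : module_action act.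
Hypothesis act_x : forall i p, act (x i) p = shift_op (u i) (s i) p.
Hypothesis actZ : forall c p, act c%:A p = c *: p.

Local Notation P := (action_module act_ok : lmodType A).
Local Notation V := (restrict_scalars P).

Definition monomial_line (d : nat) : set P :=
  [set p | exists c : C, p = c *: 'X^d :> {poly C}].

(** The two structures of vector space on the carrier of [P] agree; this is what
    allows coefficients of polynomials to be used below. *)
Lemma act_scale (c : C) (p : V) : c *: p = c *: (p : {poly C}) :> {poly C}.
Proof. exact: actZ. Qed.

Lemma actZl c a p : act (c *: a) p = c *: act a p.
Proof. by rewrite -actZ (mactA act_ok) -scalerAl mul1r. Qed.

Lemma actZr c a p : act a (c *: p) = c *: act a p.
Proof. by rewrite -actZ (mactA act_ok) -scalerAr mulr1 actZl. Qed.

Lemma act_word (w : seq 'I_n.+1) (e : nat) :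
  exists c, act (\prod_(i <- w) x i) 'X^e = c *: 'X^(size w + e).
Proof.
elim: w => [|i w [c IH]].
  by exists 1; rewrite big_nil (mact1 act_ok) scale1r.
exists (c * (u i * s i ^+ (size w + e))).
by rewrite big_cons -(mactA act_ok) IH act_x linearZ /= shift_opXn scalerA.
Qed.

Lemma weighted_grading : module_grading x monomial_line.
Proof.
split.
- move=> d; split; first by exists 0; rewrite scale0r.
  move=> c p r [a ->] [b ->]; exists (c * a + b).
  by rewrite act_scale scalerA scalerDl.
- move=> d e a m [t [t_word ->]] [c ->].
  rewrite scaler_suml big_seq.
  elim/big_rec: _ => [|[a' w] r tin [b ->]]; first by exists 0; rewrite scale0r.
  have [ww /= ->] := t_word _ tin.
  have [c' cE] := act_word ww e.
  exists (a' * (c * c') + b); rewrite scalerDl; congr (_ + _).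
  apply: (etrans (actZl _ _ _)).
  by rewrite actZr cE !scalerA mulrA size_tuple.
- move=> m; exists (size (m : {poly C})), (fun d => (m : {poly C})`_d *: 'X^d).
  split; first by move=> d; exists (m : {poly C})`_d.
  by rewrite -[LHS](coefK (m : {poly C})) poly_def.
- move=> N f f_gr f0 d dN.
  have [c fE] := choice f_gr.
  have fcE : \sum_(d < N) f d = \poly_(d < N) c d :> {poly C}.
    by rewrite poly_def; apply: eq_bigr => k _; exact: fE.
  have := congr1 (fun p : {poly C} => p`_d) (etrans (esym f0) fcE).
  by rewrite /= coef0 coef_poly dN fE => <-; rewrite scale0r.
Qed.

Lemma monomial_line_dim d : @lin_dim C V R (monomial_line d) = 1%E.
Proof.
apply/le_anti/andP; split.
  apply: (@lin_dim_le_span _ _ _ _ 1 (fun=> 'X^d : V)) => p [c ->].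
  by exists (fun=> c); rewrite big_ord1 act_scale.
apply: (@lin_dim_ge_indep _ _ _ _ 1 (fun=> 'X^d : V)).
  by move=> _; exists 1; rewrite scale1r.
move=> c; rewrite big_ord1 => cX0 i; rewrite ord1.
have /eqP : c ord0 *: 'X^d = 0 :> {poly C} := etrans (esym (act_scale _ _)) cX0.
by rewrite scaler_eq0 -size_poly_eq0 size_polyXn orbF => /eqP.
Qed.

Variable i0 : 'I_n.+1.
Hypotheses (u0 : u i0 != 0) (s0 : s i0 != 0).

Lemma act_pow1 k : exists c, c != 0 /\ act (x i0 ^+ k) 1 = c *: 'X^k.
Proof.
elim: k => [|k [c [c0 IH]]].
  by exists 1; split; rewrite ?oner_eq0 // expr0 (mact1 act_ok) scale1r expr0.
exists (c * (u i0 * s i0 ^+ k)); split; first by rewrite !mulf_neq0 // expf_neq0.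
by rewrite exprS -(mactA act_ok) IH act_x linearZ /= shift_opXn scalerA.
Qed.

Lemma size_act_pow k p : p != 0 -> size (act (x i0 ^+ k) p) = (k + size p)%N.
Proof.
move=> p0; elim: k => [|k IH]; first by rewrite expr0 (mact1 act_ok).
rewrite exprS -(mactA act_ok) act_x size_shift_op ?IH //.
by rewrite -size_poly_eq0 IH addn_eq0 size_poly_eq0 (negPf p0) andbF.
Qed.

Lemma act_pow1_indep d : lin_indep (fun k : 'I_d => (x i0 ^+ k *: (1 : P) : V)).
Proof.
have [c cP] := choice act_pow1.
move=> a a0 k.
have sumE : \sum_(k < d) a k *: (x i0 ^+ k *: (1 : P) : V) =
    \sum_(k < d) (a k * c k) *: 'X^k :> {poly C}.
  by apply: eq_bigr => j _; rewrite act_scale -scalerA -(cP j).2.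
have := congr1 (fun p : {poly C} => p`_k) (etrans (esym a0) sumE).
rewrite /= coef0 coef_sum (bigD1 k) //= coefZ coefXn eqxx mulr1 big1.
  by rewrite addr0 => /esym/eqP; rewrite mulf_eq0 (negPf (cP _).1) orbF => /eqP.
move=> j jk; rewrite coefZ coefXn.
by rewrite (_ : (k : nat) == j = false) ?mulr0 // eq_sym; apply/negbTE.
Qed.

(** Let [p] be a nonzero element of the kernel.  As [x i0] raises the degree by
    exactly one, the kernel contains a polynomial of each degree at least that of
    [p], so every polynomial can be reduced below the degree of [p] without
    changing its image: the images of the smaller monomials span the quotient.
    The kernel need not be homogeneous. *)
Lemma quotient_fin (Q : lmodType A) (f : {linear P -> Q}) (p : P) :
    p != 0 -> f p = 0 -> (forall y, exists m, f m = y) ->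
  forall y : restrict_scalars Q, exists c : 'I_(size (p : {poly C})).-1 -> C,
    y = \sum_j c j *: (f ('X^j : {poly C}) : restrict_scalars Q).
Proof.
move=> p0 fp0 f_surj y; have [r <-] := f_surj y.
set D := _.-1.
have fZ (c : C) (m : {poly C}) :
    f (c *: m : {poly C}) = c *: (f m : restrict_scalars Q) :> Q.
  by rewrite -[X in f X]actZ; exact: (linearZ_LR f c%:A m).
suff [r' r'D ->] : exists2 r', (size (r' : {poly C}) <= D)%N & f r = f r'.
  exists (fun j => (r' : {poly C})`_j).
  have r'E : r' = \sum_(j < D) (r' : {poly C})`_j *: 'X^j :> {poly C}.
    rewrite -poly_def; apply/polyP => j; rewrite coef_poly.
    by case: ltnP => // Dj; rewrite nth_default // (leq_trans r'D).
  have fS (E : 'I_D -> P) : f (\sum_j E j) = \sum_j f (E j) by rewrite raddf_sum.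
  rewrite [X in f X = _]r'E; apply: (etrans (fS _)).
  by apply: eq_bigr => j _; exact: fZ.
have [N] := ubnP (size (r : {poly C})); elim: N r => // N IH r.
rewrite ltnS => rN; have [rD|Dr] := leqP (size (r : {poly C})) D.
  by exists r.
(* The multiple of [p] with the degree of [r], to cancel its leading term. *)
pose h : {poly C} := act (x i0 ^+ (size (r : {poly C}) - size (p : {poly C}))) p.
have hr : size h = size (r : {poly C}).
  rewrite size_act_pow // subnK //.
  by rewrite (leq_trans (leqSpred _)).
have fh0 : f h = 0 by rewrite [f h](linearZ_LR f) fp0 scaler0.
have h0 : lead_coef h != 0.
  by rewrite lead_coef_eq0 -size_poly_eq0 hr -lt0n (leq_trans _ Dr).
pose k := lead_coef (r : {poly C}) / lead_coef h.
pose r1 : {poly C} := (r : {poly C}) - k *: h.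
have rkh : (size r1 < size (r : {poly C}))%N.
  have r_gt0 : (0 < size (r : {poly C}))%N by rewrite (leq_trans _ Dr).
  rewrite -[ltnRHS](prednK r_gt0) ltnS; apply/leq_sizeP => j.
  rewrite leq_eqVlt => /predU1P[<-|].
    by rewrite coefB coefZ -{2}hr -!lead_coefE divfK // subrr.
  rewrite prednK // => rj.
  by rewrite coefB coefZ !nth_default ?hr // mulr0 subr0.
have [|r' r'D fr'] := IH r1.
  exact: leq_trans rkh rN.
have fkh : f (k *: h : {poly C}) = 0 by rewrite fZ fh0 scaler0.
have fB : f r1 = f r - f (k *: h : {poly C}) by exact: raddfB.
by exists r' => //; rewrite -fr' fB fkh subr0.
Qed.

Lemma weighted_critical : critical R P.
Proof.
move=> Q f f_surj f_ninj; apply: (@lt_le_trans _ _ 1%E); last first.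
  exact: (gkdim_ge1 R act_pow1_indep).
have [p p0 fp0] : exists2 p : P, p != 0 & f p = 0.
  apply: contrapT => no_p; apply: f_ninj => a b fab; apply/eqP.
  rewrite -subr_eq0; apply/negPn/negP => ab0; apply: no_p; exists (a - b) => //.
  have fB : f (a - b) = f a - f b by exact: raddfB.
  by rewrite fB fab subrr.
apply: (le_lt_trans (gkdim_fin_le0 R (quotient_fin p0 fp0 f_surj))).
by rewrite lte_fin.
Qed.

Local Notation l := (fun m => \sum_j line_eqs u i0 m j *: x j).

Lemma weighted_cyclic (p : P) : exists a, p = a *: (1 : P).
Proof.
have [c cP] := choice act_pow1.
exists (\sum_(d < size (p : {poly C})) ((p : {poly C})`_d / c d) *: x i0 ^+ d).
rewrite scaler_suml -[LHS](coefK (p : {poly C})) poly_def; apply: eq_bigr => d _.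
by apply/esym/(etrans (actZl _ _ _)); rewrite (cP d).2 scalerA divfK // (cP d).1.
Qed.

(** By the normal form it is enough to look at polynomials in [x i0], and the
    powers of [x i0] applied to [1] are independent. *)
Lemma weighted_annihilator a : a *: (1 : P) = 0 <-> left_ideal l a.
Proof.
have l0 m : l m *: (1 : P) = 0.
  pose F j : {poly C} := act (x j) 1.
  have -> : l m *: (1 : P) = \sum_j line_eqs u i0 m j *: F j.
    by rewrite scaler_suml; apply: eq_bigr => j _; exact: actZl.
  rewrite line_eqsE /F !act_x -(expr0 'X) !shift_opXn !expr0 !mulr1.
  by rewrite scalerA divfK // subrr.
split=> [a0|[b ->]]; last first.
  by rewrite scaler_suml big1 // => m _; rewrite -scalerA [X in _ *: X]l0 scaler0.
have [g [b ag]] := qpa_normal_form hA u i0 a.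
suff g0 : g = 0 by exists b; rewrite -ag g0 linear0 subr0.
have hg : horner_alg (x i0) g *: (1 : P) = 0.
  rewrite -(subKr a (horner_alg _ _)) ag scalerBl a0 sub0r scaler_suml.
  rewrite big1 ?oppr0 //.
  by move=> m _; rewrite -scalerA [X in _ *: X]l0 scaler0.
apply/polyP => d; rewrite coef0; have [gd|dg] := leqP (size g) d.
  exact: nth_default.
apply: (act_pow1_indep (c := fun k : 'I_(size g) => g`_k) _ (Ordinal dg)).
apply: etrans hg; rewrite horner_algE scaler_suml; apply: eq_bigr => k _.
by rewrite act_scale; exact/esym/actZl.
Qed.

Lemma weighted_point_module : point_module x monomial_line.
Proof.
split.
- exact: weighted_grading.
- by exists (1 : P); [exists 1; rewrite scale1r | exact: weighted_cyclic].
- exact: weighted_critical.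
- exact: monomial_line_dim.
Qed.

Lemma weighted_associated_point (p : proj_point R n) : lin_indep x ->
  val p = <[\row_j u j]>%VS -> associated_point x monomial_line p.
Proof.
move=> x_free pE; exists (1 : P), l, (line_eqs u i0); split.
- by exists 1; rewrite scale1r.
- exact: weighted_cyclic.
- exact: weighted_annihilator.
- by split=> //; exact: line_eqs_indep.
- move=> w; rewrite pE; have wP := line_eqsP (fun j => w 0 j) u0.
  split=> [/vlineP[k wk]|/wP[k wk]].
    by apply/wP; exists k => j; rewrite wk !mxE.
  by apply/vlineP; exists k; apply/rowP => j; rewrite wk !mxE.
Qed.

End WeightedLine.

(** * Coordinate planes in the point variety *)

Section ScalarAction.
Variables (K : fieldType) (A : algType K) (M : lmodType A).
Implicit Types (c d : K) (a : A) (m : M).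

Lemma scale_algl c a m : (c *: a) *: m = c%:A *: (a *: m).
Proof. by rewrite scalerA -scalerAl mul1r. Qed.

Lemma scale_algr c a m : a *: (c%:A *: m) = c%:A *: (a *: m).
Proof. by rewrite !scalerA -scalerAl mul1r -scalerAr mulr1. Qed.

Lemma scale_algM c d m : c%:A *: (d%:A *: m) = (c * d)%:A *: m.
Proof. by rewrite -scale_algl scalerA. Qed.

End ScalarAction.

Section CoordinatePlanes.
Variables (R : realType) (n : nat) (q : 'M[R[i]]_n.+1).
Local Notation C := (R[i]).
Variables (A : algType C) (x : 'I_n.+1 -> A).
Hypothesis hA : quantum_polynomial_algebra q x.

(** The hypothesis is the relation between [x i] and [x j] evaluated on the
    operators of parameters [u] and [s]; it constrains the ratio of [s i] and
    [s j] only where both coordinates of [u] are nonzero. *)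
Lemma weighted_action (u s : 'I_n.+1 -> C) :
    (forall i j, u i * u j * s i = q i j * (u i * u j * s j)) ->
  exists act : A -> {poly C} -> {poly C},
    [/\ module_action act, forall i p, act (x i) p = shift_op (u i) (s i) p
      & forall c p, act c%:A p = c *: p].
Proof.
move=> us; apply: (qpa_action hA (X := fun i => shift_op (u i) (s i))) => i j p /=.
rewrite !shift_op_comp scalerA us (mulrC (s j)).
by rewrite (mulrC (u j)).
Qed.

(** When [u] is the [a]-th coordinate point, all the generators other than [x a]
    act by zero, which isolates the [a]-th coefficient of a linear relation. *)
Lemma qpa_gen_indep : lin_indep x.
Proof.
move=> c c0 a.
have [|act [act_ok act_x actZ]] :=
  @weighted_action (fun i => (i == a)%:R) (fun=> 1).
  move=> i j; have [->|_] := eqVneq i a; last by rewrite !mul0r mulr0.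
  have [->|_] := eqVneq j a; last by rewrite mulr0 mul0r mulr0.
  by rewrite (qpa_diag hA) mul1r.
have : \sum_i c i *: act (x i) 1 = 0.
  transitivity ((\sum_i c i *: x i) *: (1 : action_module act_ok)).
    rewrite scaler_suml; apply: eq_bigr => i _.
    by apply: esym; exact: (actZl act_ok actZ).
  by rewrite c0 scale0r.
rewrite (bigD1 a) //= big1 ?addr0 => [|i /negPf ia].
  rewrite act_x eqxx -(expr0 'X) shift_opXn expr0 mulr1 scale1r => /eqP.
  by rewrite scaler_eq0 -size_poly_eq0 size_polyXn orbF => /eqP.
by rewrite act_x ia /shift_op scale0r scaler0.
Qed.

Lemma weighted_point (u s : 'I_n.+1 -> C) (i0 : 'I_n.+1) (p : proj_point R n) :
    (forall i j, u i * u j * s i = q i j * (u i * u j * s j)) ->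
    u i0 != 0 -> s i0 != 0 -> val p = <[\row_j u j]>%VS ->
  point_variety x p.
Proof.
move=> us u0 s0 pE; have [act [act_ok act_x actZ]] := weighted_action us.
exists (action_module act_ok), (monomial_line (act_ok := act_ok)); split.
  exact: (weighted_point_module act_ok act_x actZ u0 s0).
exact: (weighted_associated_point hA act_ok act_x actZ u0 s0 qpa_gen_indep pE).
Qed.

Lemma coord_planeP (i j k : 'I_n.+1) (p : proj_point R n) (w : 'rV[C]_n.+1) :
  coord_plane i j k p -> w \in val p -> forall m, m \notin [:: i; j; k] -> w 0 m = 0.
Proof.
move=> /subvP/[apply]; rewrite !span_cons span_nil addv0.
move=> /memv_addP[_ /vlineP[a ->] [_ /memv_addP[_ /vlineP[b ->] [_ /vlineP[c ->] ->]] ->]].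
move=> m; rewrite !inE !negb_or => /and3P[mi mj mk].
by rewrite !mxE (negPf mi) (negPf mj) (negPf mk) !andbF !mulr0 !addr0.
Qed.

Lemma proj_pointE (p : proj_point R n) :
  exists2 w : 'rV[C]_n.+1, w != 0 & val p = <[w]>%VS.
Proof.
have /eqP dimp := valP p; exists (vpick (val p)).
  by rewrite vpick0 -dimv_eq0 dimp.
apply/eqP; rewrite eq_sym eqEdim dimp dim_vline vpick0 -dimv_eq0 dimp /= andbT.
by rewrite -memvE memv_pick.
Qed.

(** The weights [s m := q m k] satisfy [s a = q a b * s b] for all [a], [b] among
    [i], [j], [k] precisely because of the hypothesis, and a point of the plane
    has no other nonzero coordinate. *)
Lemma plane_sub_point_variety (i j k : 'I_n.+1) :
  q i j * q j k * q k i = 1 -> coord_plane i j k `<=` point_variety x.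
Proof.
move=> qijk p pP; have [w w0 pE] := proj_pointE p.
have wP m : w 0 m != 0 -> m \in [:: i; j; k].
  move=> wm; apply/negPn/negP => mP; apply/negP: wm; rewrite negbK; apply/eqP.
  by apply: (coord_planeP pP) => //; rewrite pE memv_line.
have [i0 wi0] : exists i0, w 0 i0 != 0.
  by apply/existsP; rewrite -negb_forall; apply: contra w0 => /forallP w0;
    apply/eqP/rowP => m; rewrite mxE; apply/eqP.
apply: (@weighted_point (fun m => w 0 m) (fun m => q m k) i0) => //; last first.
- by rewrite pE; congr (<[_]>%VS); apply/rowP => m; rewrite mxE.
- exact: (qpa_neq0 hA).
move=> a b.
have [->|/wP aP] := eqVneq (w 0 a) 0; first by rewrite !mul0r mulr0.
have [->|/wP bP] := eqVneq (w 0 b) 0; first by rewrite mulr0 !mul0r mulr0.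
suff -> : q a k = q a b * q b k by rewrite mulrCA.
have qK c d : q c d * q d c = 1.
  by rewrite (qpa_inv hA c d) mulfV // (qpa_neq0 hA).
have qik : q i k = q i j * q j k.
  by rewrite -[RHS]mulr1 -(qK k i) mulrA qijk mul1r.
have qjk : q j k = q j i * q i k by rewrite qik mulrA qK mul1r.
move: aP bP; rewrite !inE => /or3P[]/eqP-> /or3P[]/eqP->;
  by rewrite ?(qpa_diag hA) ?mul1r ?mulr1 ?qK.
Qed.

Section AnnihilatedForms.
Variables (P : lmodType A) (gr : nat -> set P) (p : proj_point R n).

(** The forms [l] cut out the single point [p], so a form that vanishes at [p] is
    a combination of them, and therefore annihilates the generator [v]. *)
Lemma associated_point_form : associated_point x gr p ->
  exists v : P, [/\ gr 0%N v, forall m, exists a, m = a *: v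
    & forall r : 'I_n.+1 -> C,
       (forall w, w \in val p -> \sum_j r j * w 0 j = 0) ->
       (\sum_j r j *: x j) *: v = 0].
Proof.
move=> [v [l [c [v0 v_cyc ann [_ lE] cE]]]]; exists v; split=> // r r0.
(* The columns of the cokernel of [c] span the solutions of [c *m w = 0]. *)
have /submxP[D rD] : ((\row_j r j) <= c)%MS.
  rewrite submxE; apply/eqP/rowP => t; rewrite !mxE.
  pose w := \row_j cokermx c j t.
  have /r0 : w \in val p.
    apply/cE => m; have /matrixP/(_ m t) := mulmx_coker c.
    rewrite !mxE => cw0; rewrite -[RHS]cw0.
    by apply: eq_bigr => j _; rewrite mxE.
  by move=> rw0; rewrite -[RHS]rw0; apply: eq_bigr => j _; rewrite !mxE.
apply/ann; exists (fun m => (D 0 m)%:A).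
under [RHS]eq_bigr do rewrite -scalerAl mul1r lE scaler_sumr.
rewrite exchange_big; apply: eq_bigr => j _ /=.
under eq_bigr do rewrite scalerA.
by rewrite -scaler_suml; have /rowP/(_ j) := rD; rewrite !mxE => ->.
Qed.

(** The gradation being direct, nothing would be left in degree 2. *)
Lemma point_module_not_spanned2 (v e : P) :
    point_module x gr -> gr 0%N v -> gr 1%N e ->
  ~ (forall m, exists c1 c2 : C, m = c1%:A *: v + c2%:A *: e).
Proof.
move=> [gr_ok _ _ hilb] v0 e1 span_ve.
have [gr_sub _ _ gr_direct] := gr_ok.
have grZ d (c : C) m : gr d m -> gr d (c%:A *: m).
  move=> gm; have [g0 gP] := gr_sub d.
  by have := gP c m 0 gm g0; rewrite addr0.
have gr20 m : gr 2%N m -> m = 0.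
  move=> m2; have [c1 [c2 mE]] := span_ve m.
  pose f d := nth 0 [:: c1%:A *: v; c2%:A *: e; - m] d.
  have f_gr d : gr d (f d).
    case: d => [|[|[|d]]] /=; [exact: grZ | exact: grZ | |].
      rewrite /f /= -scaleN1r -[X in - X]scale1r -scaleNr; exact: grZ.
    by rewrite /f /= nth_nil; exact: (lin_subspace0 (gr_sub _)).
  have f0 : \sum_(d < 3) f d = 0.
    by rewrite !big_ord_recl big_ord0 /f /= addr0 addrA -mE subrr.
  by have /eqP := gr_direct 3%N f f_gr f0 2%N isT; rewrite /f /= oppr_eq0 => /eqP.
have := @lin_dim_le0 _ _ R (gr 2%N : set (restrict_scalars P)) gr20.
by rewrite hilb lee_fin ler10.
Qed.

End AnnihilatedForms.

(** It suffices that one point of the plane, the one with three coordinates equal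
    to 1, belongs to the point variety. *)
Lemma point_variety_eq1 (i j k : 'I_n.+1) : distinct3 i j k ->
  coord_plane i j k `<=` point_variety x -> q i j * q j k * q k i = 1.
Proof.
move=> /and3P[ij ik jk] plane_sub.
pose u (m : 'I_n.+1) : C := (m \in [:: i; j; k])%:R.
pose U : 'rV[C]_n.+1 := \row_m u m.
have ui : u i = 1 by rewrite /u inE eqxx.
have uj : u j = 1 by rewrite /u !inE eqxx orbT.
have uk : u k = 1 by rewrite /u !inE eqxx !orbT.
have U0 : U != 0.
  by apply/eqP => /rowP/(_ i)/eqP; rewrite !mxE ui oner_eq0.
have dimU : \dim <[U]>%VS == 1%N by rewrite dim_vline U0.
pose p : proj_point R n := exist _ <[U]>%VS dimU.
have pP : coord_plane i j k p.
  rewrite /coord_plane /= -memvE.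
  have -> : U = coord_point i + (coord_point j + coord_point k).
    apply/rowP => m; rewrite !mxE /u !inE.
    have [->|mi] := eqVneq m i; first by rewrite (negPf ij) (negPf ik) !addr0.
    have [->|mj] := eqVneq m j; first by rewrite (negPf jk) addr0 add0r.
    by rewrite !add0r.
  by rewrite !memvD // memv_span // !inE eqxx ?orbT.
have [P [gr [P_point P_assoc]]] := plane_sub p pP.
have [v [v0 v_cyc v_form]] := associated_point_form P_assoc.
pose e := x i *: v.
have xv m : x m *: v = (u m)%:A *: e.
  (* The form [X_m - u m * X_i] vanishes at [u], as [u i = 1]. *)
  pose r t : C := (t == m)%:R - u m * (t == i)%:R.
  have rE (V : lmodType C) (F : 'I_n.+1 -> V) :
      \sum_t r t *: F t = F m - u m *: F i.
    under eq_bigr do rewrite scalerBl.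
    rewrite sumrB; congr (_ - _).
      rewrite (bigD1 m) //= eqxx scale1r big1 ?addr0 // => t /negPf ->.
      by rewrite scale0r.
    rewrite (bigD1 i) //= eqxx mulr1 big1 ?addr0 // => t /negPf ->.
    by rewrite mulr0 scale0r.
  have := v_form r; rewrite rE scalerBl => xv0.
  apply/eqP; rewrite -subr_eq0 -scale_algl; apply/eqP/xv0.
  move=> w /vlineP[c ->]; apply: etrans (rE C^o (fun t => (c *: U) 0 t)) _.
  by rewrite !mxE ui mulr1 [u m *: _]mulrC subrr.
(* The relation between [x a] and [x b], applied to [v]. *)
have xe a b : (u b)%:A *: (x a *: e) = (q a b * u a)%:A *: (x b *: e).
  have xxv c d : (x c * x d) *: v = (u d)%:A *: (x c *: e).
    by rewrite -(scalerA (x c)) xv scale_algr.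
  rewrite -xxv (qpa_commute hA a b).
  by apply: etrans (scale_algl _ _ _) _; rewrite xxv scale_algM.
pose z := x i *: e.
have xei a : x a *: e = (q a i * u a)%:A *: z.
  by rewrite -xe ui !scale1r.
apply: contrapT => /eqP; rewrite -subr_eq0 => q_neq1.
(* The relation for [j], [k], both sides expressed through [z], gives
   [q j i *: z = q j k * q k i *: z]. *)
have z0 : z = 0.
  have /eqP := xe j k; rewrite !xei uj uk !scale_algM !mulr1 mul1r -subr_eq0.
  rewrite -!scalerBl => /eqP/(congr1 (fun m => (q i j)%:A *: m)).
  rewrite scaler0 scale_algM mulrBr (qpa_inv hA i j) mulfV ?(qpa_neq0 hA) //.
  rewrite -opprB mulrA; set t := - _.
  move=> /(congr1 (fun m => t^-1%:A *: m)).
  by rewrite scaler0 scale_algM mulVf ?oppr_eq0 // !scale1r.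
have {xei} xe0 a : x a *: e = 0 by rewrite xei z0 scaler0.
apply: (point_module_not_spanned2 P_point v0 (e := e)).
  have [gr_ok _ _ _] := P_point; have := mgr_action gr_ok (d := 1) (a := x i) _ v0.
  apply; exists [:: (1, x i)]; split; last by rewrite big_seq1 scale1r.
  move=> t; rewrite inE => /eqP -> /=; exists [tuple i].
  by rewrite big_cons big_nil mulr1.
move=> m; have [a ->] := v_cyc m.
move: a; apply: (qpa_ind hA).
- by exists 1, 0; rewrite scale0r scale0r addr0 !scale1r.
- move=> c a b [a1 [a2 aE]] [b1 [b2 bE]]; exists (c * a1 + b1), (c * a2 + b2).
  rewrite scalerDl scale_algl aE bE scalerDr !scale_algM addrACA.
  by rewrite !scalerDl.
- move=> t a [c1 [c2 aE]]; exists 0, (c1 * u t).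
  rewrite -(scalerA (x t)) aE scalerDr !scale_algr xe0 scaler0 addr0 xv scale_algM.
  by rewrite scale0r scale0r add0r.
Qed.

End CoordinatePlanes.

Theorem proposition5 (R : realType) (n : nat) (q : 'M[R[i]%C]_n.+1)
    (A : algType R[i]%C) (x : 'I_n.+1 -> A)
    (hA : quantum_polynomial_algebra q x) :
  adequate (planes_not_in (point_variety x)).
Proof.
split=> [L [i [j [k [ijk -> _]]]]|i j k l jkl]; first by exists i, j, k.
move=> [_ [_ [_ [_ _ not_sub]]]].
have q_neq1 : q j k * q k l * q l j != 1.
  by apply/eqP => q1; apply: not_sub; exact: plane_sub_point_variety q1.
have newplane u v : u \in [:: j; k; l] -> v \in [:: j; k; l] ->
    distinct3 i u v -> q i u * q u v * q v i != 1 ->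
    exists u v, [/\ u \in [:: j; k; l], v \in [:: j; k; l], distinct3 i u v
      & planes_not_in (point_variety x) (coord_plane i u v)].
  move=> uP vP iuv /eqP q1; exists u, v; split=> //; exists i, u, v; split=> //.
  by move/(point_variety_eq1 hA iuv).
have [jk jl kl] := and3P jkl.
have qV a b : q a b * q b a = 1.
  by rewrite (qpa_inv hA a b) mulfV // (qpa_neq0 hA).
(* When [i] is one of [j], [k], [l], the other two span the same plane with it. *)
have [ij|ij] := eqVneq i j.
  apply: (newplane k l); rewrite ?inE ?eqxx ?orbT // ij //.
have [ik|ik] := eqVneq i k.
  apply: (newplane l j); rewrite ?inE ?eqxx ?orbT // ik.
    by rewrite /distinct3 kl eq_sym jk eq_sym jl.
  by rewrite mulrC mulrA.
have [il|il] := eqVneq i l.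
  apply: (newplane j k); rewrite ?inE ?eqxx ?orbT // il.
    by rewrite /distinct3 eq_sym jl eq_sym kl jk.
  by rewrite -mulrA mulrC.
have [qijk|] := eqVneq (q i j * q j k * q k i) 1; last first.
  by apply: newplane; rewrite ?inE ?eqxx ?orbT // /distinct3 ij ik.
have [qikl|] := eqVneq (q i k * q k l * q l i) 1; last first.
  by apply: newplane; rewrite ?inE ?eqxx ?orbT // /distinct3 ik il.
apply: (newplane l j); rewrite ?inE ?eqxx ?orbT //.
  by rewrite /distinct3 il ij eq_sym.
apply: contra q_neq1 => /eqP qilj; apply/eqP.
have : (q i j * q j k * q k i) * (q i k * q k l * q l i) * (q i l * q l j * q j i) =
    (q j k * q k l * q l j) * (q i j * q j i) * (q i k * q k i) * (q i l * q l i).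
  by ring.
by rewrite qijk qikl qilj !qV !mulr1 => <-.
Qed.
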